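(* For complex numbers $s$ and $z$ with $0<|z|<1$, let \[ B(n,s)=\frac{\left(\frac{s}{2}\right)_n\left(\frac{1-s}{2}\right)_n\left(\frac{1+s}{2}\right)_n\left(1-\frac{s}{2}\right)_n}{\left(\frac12\right)_n(1)_n^3}. \] Then \[ \sum_{n=0}^{\infty} B(n,s) z^n \left[ \frac{s(s^2-1)(s-2)+4(1+2s-2s^2)n+8(1+s-s^2)n^2}{2n+1} - \frac{8(1-z)}{z}n^3+12n^2 \right]=0. \]
   Context: For a complex number $a$ and integer $n\ge 0$, $(a)_n=a(a+1)\cdots(a+n-1)$ denotes the Pochhammer symbol (rising factorial), with $(a)_0=1$. *)

(* Defs.v *)
From Stdlib Require Import Reals.
From Coquelicot Require Import Coquelicot.

Open Scope C_scope.

Fixpoint pochhammer (a : C) (n : nat) : C :=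
  match n with
  | O => 1
  | S m => pochhammer a m * (a + INR m)
  end.

Definition B (n : nat) (s : C) : C :=
  (pochhammer (s / 2) n * pochhammer ((1 - s) / 2) n
   * pochhammer ((1 + s) / 2) n * pochhammer (1 - s / 2) n)
  / (pochhammer (1 / 2) n * pochhammer 1 n ^ 3).

(* Main.v *)
Require Import Defs.
From Stdlib Require Import Reals Lra Lia.
From Coquelicot Require Import Coquelicot.

(** Put [G n = 8 n^3 B(n,s) z^(n-1)].  The recurrence for [B(n+1,s) / B(n,s)]
    shows that the [n]-th term of the series is [G (n+1) - G n].  As [G 0 = 0],
    the partial sums are [G (n+1)], and these tend to [0] because
    [|G (n+1)| <= |z| (1 + A/n)^4 |G n|] for a constant [A]. *)

Open Scope C_scope.

Lemma RtoC_neq_0 (x : R) : x <> 0%R -> RtoC x <> 0.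
Proof. intros Hx E. apply Hx, RtoC_inj, E. Qed.

Lemma pochhammer_neq_0 (a : R) (n : nat) : (0 < a)%R -> pochhammer a n <> 0.
Proof.
  intros Ha. induction n as [|n IH]; simpl.
  - apply RtoC_neq_0; lra.
  - apply Cmult_neq_0; [exact IH|].
    rewrite <- RtoC_plus. apply RtoC_neq_0.
    generalize (pos_INR n); lra.
Qed.

(** Each Pochhammer symbol gains one linear factor when [n] grows by one. The denominators are
    cleared, so the recurrence can be rewritten with inside a product. *)
Lemma B_succ (n : nat) (s : C) :
  B (S n) s * ((INR n + 1 / 2) * (INR n + 1) ^ 3) =
  B n s * ((s / 2 + INR n) * ((1 - s) / 2 + INR n)
           * ((1 + s) / 2 + INR n) * (1 - s / 2 + INR n)).
Proof.
  assert (Hn := pos_INR n).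
  assert (H1 : pochhammer (1 / 2) n <> 0).
  { rewrite <- RtoC_div by lra. apply pochhammer_neq_0; lra. }
  assert (H2 : pochhammer 1 n <> 0) by (apply pochhammer_neq_0; lra).
  assert (H3 : 1 + INR n * 2 <> 0).
  { rewrite <- RtoC_mult, <- RtoC_plus. apply RtoC_neq_0; lra. }
  assert (H4 : 1 + INR n <> 0).
  { rewrite <- RtoC_plus. apply RtoC_neq_0; lra. }
  unfold B. simpl pochhammer.
  field. repeat split; trivial.
Qed.

Lemma Cmod_plus_INR_le (a : C) (n : nat) :
  (Cmod (a + INR n) <= INR n + Cmod a)%R.
Proof.
  eapply Rle_trans; [apply Cmod_triangle|].
  rewrite Cmod_R, Rabs_pos_eq by apply pos_INR. lra.
Qed.

(** Ratio test: for [r] strictly between [l] and 1, eventually [c n < r], so from some index on [u]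
    lies below a geometric sequence of ratio [r]. *)
Lemma is_lim_seq_0_ratio (u c : nat -> R) (l : R) :
  (l < 1)%R -> (forall n, 0 <= u n)%R ->
  (forall n, u (S n) <= c n * u n)%R -> is_lim_seq c l -> is_lim_seq u 0%R.
Proof.
  intros Hl Hu Hc Hlim.
  (* The midpoint of [l] and 1 may be negative; the maximum with 1/2 keeps [r] positive. *)
  set (r := Rmax (1 / 2) ((l + 1) / 2)).
  assert (Hr : (0 < r < 1 /\ l < r)%R).
  { unfold r, Rmax; destruct Rle_dec; lra. }
  destruct Hr as [Hr Hlr].
  apply is_lim_seq_spec in Hlim.
  assert (He : (0 < r - l)%R) by lra.
  destruct (Hlim (mkposreal _ He)) as [N HN]. simpl in HN.
  apply (is_lim_seq_incr_n u N).
  assert (Hb : forall k, (u (k + N)%nat <= u N * r ^ k)%R).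
  { induction k as [|k IH]; simpl; [lra|].
    eapply Rle_trans; [apply Hc|].
    assert (HcN := HN (k + N)%nat ltac:(lia)).
    apply Rabs_def2 in HcN.
    assert (Hk := Hu (k + N)%nat).
    apply Rle_trans with (r * u (k + N)%nat)%R.
    - apply Rmult_le_compat_r; lra.
    - apply Rle_trans with (r * (u N * r ^ k))%R; [|lra].
      apply Rmult_le_compat_l; lra. }
  apply is_lim_seq_le_le with (u := fun _ => 0%R) (w := fun k => (u N * r ^ k)%R).
  - intros k; split; [apply Hu | apply Hb].
  - apply is_lim_seq_const.
  - replace (Finite 0) with (Rbar_mult (u N) 0) by (simpl; f_equal; ring).
    apply is_lim_seq_scal_l, is_lim_seq_geom.
    rewrite Rabs_pos_eq; lra.
Qed.

(** Gives the limit of the ratio bound, with [m] the modulus of [z] and [k = 4]; the shift to [S n]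
    keeps the denominator nonzero. *)
Lemma is_lim_seq_one_plus_div_pow (m a : R) (k : nat) :
  is_lim_seq (fun n => (m * (1 + a / INR (S n)) ^ k)%R) m.
Proof.
  assert (H1 : is_lim_seq (fun n => (1 + a / INR (S n))%R) 1%R).
  { replace (Finite 1) with (Finite (1 + a * 0)) by (f_equal; ring).
    apply is_lim_seq_plus'; [apply is_lim_seq_const|].
    apply is_lim_seq_mult'; [apply is_lim_seq_const|].
    apply (is_lim_seq_incr_1 (fun n => / INR n)%R).
    replace (Finite 0) with (Rbar_inv p_infty) by reflexivity.
    apply is_lim_seq_inv; [apply is_lim_seq_INR | discriminate]. }
  assert (H2 : is_lim_seq (fun n => ((1 + a / INR (S n)) ^ k)%R) 1%R).
  { induction k as [|k IH]; simpl; [apply is_lim_seq_const|].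
    replace (Finite 1) with (Finite (1 * 1)) by (f_equal; ring).
    apply is_lim_seq_mult'; [exact H1 | exact IH]. }
  replace (Finite m) with (Finite (m * 1)) by (f_equal; ring).
  apply is_lim_seq_mult'; [apply is_lim_seq_const | exact H2].
Qed.

(** Since [g 0] vanishes, the sum of [a] up to and including index [n] is exactly [g (S n)]. *)
Lemma is_series_telescope (K : AbsRing) (V : NormedModule K) (a g : nat -> V) :
  g 0%nat = zero -> (forall n, a n = minus (g (S n)) (g n)) ->
  filterlim (fun n => g (S n)) eventually (locally (zero : V)) ->
  is_series a (zero : V).
Proof.
  intros Hg0 Ha Hlim.
  apply filterlim_ext with (2 := Hlim). intros n.
  induction n as [|n IH].
  - rewrite sum_O, Ha, Hg0. symmetry. exact (minus_zero_r _).
  - rewrite sum_Sn, <- IH, Ha. unfold minus.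
    rewrite (plus_comm (g (S (S n)))), plus_assoc.
    transitivity (plus (zero : V) (g (S (S n)))); [symmetry; apply plus_zero_l|].
    f_equal. symmetry. exact (plus_opp_r (g (S n))).
Qed.

(** The [G] of the overview. Writing [z ^ n / z] avoids the exponent [n - 1], which would be
    truncated at [n = 0]. *)
Definition telescoper (s z : C) (n : nat) : C :=
  8 * INR n ^ 3 * B n s * z ^ n / z.

(** The cube in [telescoper] absorbs the factor [(n + 1)^3] of [B_succ]. Only [n + 1/2] survives,
    the source of the denominator [2n + 1] in the series. *)
Lemma telescoper_succ (s z : C) (n : nat) : z <> 0 ->
  telescoper s z (S n) * (INR n + 1 / 2) =
  8 * B n s * z ^ n * ((s / 2 + INR n) * ((1 - s) / 2 + INR n)
                       * ((1 + s) / 2 + INR n) * (1 - s / 2 + INR n)).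
Proof.
  intros Hz. unfold telescoper.
  rewrite S_INR, RtoC_plus. simpl (z ^ S n).
  transitivity (8 * z ^ n * (B (S n) s * ((INR n + 1 / 2) * (INR n + 1) ^ 3))).
  - field. exact Hz.
  - rewrite B_succ. ring.
Qed.

(** Each of the four numerator factors has modulus at most [m + A], while the denominator
    [(m + 1/2) m^3] is at least [m^4]. *)
Lemma telescoper_ratio (s z : C) (A : R) (m : nat) : z <> 0 -> (0 < m)%nat ->
  (Cmod (s / 2) <= A)%R -> (Cmod ((1 - s) / 2) <= A)%R ->
  (Cmod ((1 + s) / 2) <= A)%R -> (Cmod (1 - s / 2) <= A)%R ->
  (Cmod (telescoper s z (S m))
   <= Cmod z * (1 + A / INR m) ^ 4 * Cmod (telescoper s z m))%R.
Proof.
  intros Hz Hm%lt_0_INR H1 H2 H3 H4.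
  assert (Hm0 : RtoC (INR m) <> 0) by (apply RtoC_neq_0; lra).
  (* The extra factor [m^3] turns [8 B(m,s) z^m] into [z] times [telescoper s z m]. *)
  assert (E : telescoper s z (S m) * (INR m + 1 / 2) * INR m ^ 3 =
    z * telescoper s z m * ((s / 2 + INR m) * ((1 - s) / 2 + INR m)
                       * ((1 + s) / 2 + INR m) * (1 - s / 2 + INR m))).
  { rewrite telescoper_succ by exact Hz. unfold telescoper.
    field. exact Hz. }
  apply (f_equal Cmod) in E. simpl (RtoC (INR m) ^ 3) in E.
  rewrite <- RtoC_div, <- RtoC_plus in E by lra.
  rewrite !Cmod_mult, !Cmod_R, Rabs_R1 in E.
  rewrite !Rabs_pos_eq in E by lra.
  assert (F : forall a, (Cmod a <= A)%R -> (Cmod (a + INR m) <= INR m + A)%R).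
  { intros a Ha. assert (Hb := Cmod_plus_INR_le a m). lra. }
  apply F in H1, H2, H3, H4.
  set (t := Cmod (telescoper s z (S m))) in *.
  set (t' := Cmod (telescoper s z m)) in *.
  assert (Ht : (0 <= t)%R) by apply Cmod_ge_0.
  assert (Ht' : (0 <= Cmod z * t')%R) by (apply Rmult_le_pos; apply Cmod_ge_0).
  assert (Hm3 : (0 < INR m ^ 3)%R) by (apply pow_lt; lra).
  assert (Hm4 : (0 < INR m ^ 4)%R) by (apply pow_lt; lra).
  apply Rmult_le_reg_r with (INR m ^ 4)%R; [exact Hm4|].
  replace (Cmod z * (1 + A / INR m) ^ 4 * t' * INR m ^ 4)%R
    with (Cmod z * t' * ((INR m + A) * (INR m + A) * (INR m + A) * (INR m + A)))%R
    by (field; lra).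
  (* The middle term is the left side of [E], with the cube in its unfolded form. *)
  apply Rle_trans with (t * (INR m + 1 / 2) * (INR m * (INR m * (INR m * 1))))%R.
  - replace (t * INR m ^ 4)%R
      with (t * INR m * (INR m * (INR m * (INR m * 1))))%R by ring.
    apply Rmult_le_compat_r; [exact (Rlt_le _ _ Hm3)|].
    apply Rmult_le_compat_l; lra.
  - rewrite E. apply Rmult_le_compat_l; [exact Ht'|].
    repeat apply Rmult_le_compat; trivial;
      repeat apply Rmult_le_pos; apply Cmod_ge_0.
Qed.

Lemma telescoper_lim (s z : C) : (0 < Cmod z < 1)%R ->
  is_lim_seq (fun n => Cmod (telescoper s z (S n))) 0%R.
Proof.
  intros Hz.
  (* A sum of nonnegative moduli bounds each of them. *)
  set (A := (Cmod (s / 2) + Cmod ((1 - s) / 2)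
             + Cmod ((1 + s) / 2) + Cmod (1 - s / 2))%R).
  apply is_lim_seq_0_ratio
    with (c := fun n => (Cmod z * (1 + A / INR (S n)) ^ 4)%R) (l := Cmod z).
  - apply Hz.
  - intros n. apply Cmod_ge_0.
  - assert (G1 := Cmod_ge_0 (s / 2)). assert (G2 := Cmod_ge_0 ((1 - s) / 2)).
    assert (G3 := Cmod_ge_0 ((1 + s) / 2)). assert (G4 := Cmod_ge_0 (1 - s / 2)).
    intros n. apply telescoper_ratio; try (unfold A; lra).
    + apply Cmod_gt_0, Hz.
    + apply Nat.lt_0_succ.
  - apply is_lim_seq_one_plus_div_pow.
Qed.

Theorem theorem2 (s z : C) (hz : (0 < Cmod z < 1)%R) :
  is_series (K := C_AbsRing) (V := C_NormedModule)
    (fun n : nat =>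
       B n s * z ^ n *
       ((s * (s ^ 2 - 1) * (s - 2)
         + 4 * (1 + 2 * s - 2 * s ^ 2) * INR n
         + 8 * (1 + s - s ^ 2) * INR n ^ 2) / (2 * INR n + 1)
        - 8 * (1 - z) / z * INR n ^ 3
        + 12 * INR n ^ 2))
    (RtoC 0).
Proof.
  assert (Hz : z <> 0) by apply Cmod_gt_0, hz.
  apply (is_series_telescope C_AbsRing C_NormedModule _ (telescoper s z)).
  - unfold telescoper. simpl. change (@zero C_NormedModule) with (RtoC 0).
    field. exact Hz.
  - intros n.
    assert (Hn := pos_INR n).
    assert (Hd : INR n * 2 + 1 <> 0).
    { rewrite <- RtoC_mult, <- RtoC_plus. apply RtoC_neq_0; lra. }
    assert (E := telescoper_succ s z n Hz).
    change (minus (telescoper s z (S n)) (telescoper s z n))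
      with (telescoper s z (S n) - telescoper s z n).
    (* Multiplying and dividing by [n + 1/2] exposes the left side of [E]. *)
    replace (telescoper s z (S n))
      with (telescoper s z (S n) * (INR n + 1 / 2) / (INR n + 1 / 2))
      by (field; repeat split; assumption).
    rewrite E. unfold telescoper.
    match goal with |- @eq _ ?x ?y => change (@eq C x y) end.
    (* What remains is that 16 times the product of the four linear factors equals
       [(2n + 1)(8n^3 + 12n^2)] plus the numerator over [2n + 1] in the series; [8n^3 - 8n^3/z]
       gives the term in [(1 - z)/z]. *)
    field. repeat split; assumption.
  - apply filterlim_norm_zero. exact (telescoper_lim s z hz).
Qed.
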